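(* Let $G$ be a connected graph with girth at least $5$ and $G\neq C_6$, and let $\Delta$ be the maximum degree of $G$. Then $\chi_D(G)\le \Delta+1$.
   Context: A $k$-coloring of a graph $G$ is a map $\varphi:V(G)\to\{1,\dots,k\}$; it is proper if $\varphi(v)\ne\varphi(w)$ whenever $vw\in E(G)$. A coloring $\varphi$ is distinguishing if the only automorphism $f$ of $G$ with $\varphi(f(v))=\varphi(v)$ for all $v\in V(G)$ is the identity. The distinguishing chromatic number $\chi_D(G)$ is the smallest number of colors in a proper distinguishing coloring of $G$. The girth of a graph containing no cycle is taken to be infinite (so trees satisfy the girth hypothesis). $C_6$ is the cycle on $6$ vertices. *)

(* Defs.v *)
From mathcomp Require Import all_boot.
Set Implicit Arguments. Unset Strict Implicit. Unset Printing Implicit Defensive.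

Section Graphs.
Variable T : finType.
Implicit Types e : rel T.

Definition simple_graph e := symmetric e /\ irreflexive e.

Definition connected e := forall x y : T, connect e x y.

Definition has_cycle_of_length e (n : nat) :=
  exists s : seq T, [/\ size s = n, 3 <= n, uniq s & cycle e s].

(* girth(G) >= g : every cycle has length >= g (vacuous for acyclic graphs,
   whose girth is infinite). *)
Definition girth_ge e (g : nat) := forall n, has_cycle_of_length e n -> g <= n.

Definition degree e (v : T) := #|[pred w | e v w]|.
Definition max_degree e := \max_(v : T) degree e v.

Definition automorphism e (f : T -> T) :=
  bijective f /\ forall x y, e (f x) (f y) = e x y.

Definition proper_coloring e k (phi : T -> 'I_k) :=
  forall v w, e v w -> phi v <> phi w.

Definition distinguishing e k (phi : T -> 'I_k) :=
  forall f, automorphism e f -> (forall v, phi (f v) = phi v) -> forall v, f v = v.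

End Graphs.

Definition isomorphic (T U : finType) (e : rel T) (e' : rel U) :=
  exists f : T -> U, bijective f /\ forall x y, e' (f x) (f y) = e x y.

Definition C6_rel : rel 'I_6 :=
  fun i j => (j == (i.+1 %% 6) :> nat) || (i == (j.+1 %% 6) :> nat).

Definition chiD_le (T : finType) (e : rel T) (k : nat) :=
  exists phi : T -> 'I_k, proper_coloring e phi /\ distinguishing e phi.

(* Main.v *)
(* Colour outwards from a set of vertices known to be fixed, one neighbourhood
   N(u) at a time.  An uncoloured neighbour of u with a second coloured
   neighbour is determined by these two, as there is no 4-cycle; the remaining
   ones have all colours but that of u available and receive distinct ones.
   Using colour 0 only when forced, every later vertex of colour 0 has degree
   Delta and neighbours of pairwise distinct colours.  So it suffices to start
   from a vertex v of colour 0 violating this.  If G is not regular, take v of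
   degree less than Delta.  If G is regular, give two neighbours w1, w2 of v
   the colour 1, and tell w1 from w2 by a second neighbour x of colour 0 of w2,
   w1 having none.  Colours 0 and 1 are avoided on the other neighbours of
   w1, w2, x and v, which is possible unless Delta = 2 and G = C_6. *)
Require Import Defs.
From mathcomp Require Import all_boot.
From mathcomp Require Import zify.

Set Implicit Arguments.
Unset Strict Implicit.
Unset Printing Implicit Defensive.

(** * Partial colourings and fixed vertices *)

Definition nbhd (T : finType) (e : rel T) (v : T) : {set T} := [set w | e v w].

Definition proper_on (T : finType) (e : rel T) k (C : {set T}) (phi : T -> 'I_k) :=
  forall v w, v \in C -> w \in C -> e v w -> phi v <> phi w.

Definition color_automorphism (T : finType) (e : rel T) k (phi : T -> 'I_k) (f : T -> T) :=
  automorphism e f /\ forall v, phi (f v) = phi v.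

Definition fixes (T : finType) (f : T -> T) (C : {set T}) := {in C, forall z, f z = z}.

Section GirthFive.

Variables (T : finType) (e : rel T).
Hypothesis e_sym : symmetric e.
Hypothesis e_irr : irreflexive e.
Hypothesis girth5 : girth_ge e 5.

(** * Neighbourhoods in the absence of triangles and 4-cycles *)

Lemma edge_neq a b : e a b -> a != b.
Proof. by apply: contraTneq => ->; rewrite e_irr. Qed.

Lemma no_triangle a b c : e a b -> e b c -> e a c -> False.
Proof.
move=> ab bc ac; have := girth5 (n := 3); suff h : has_cycle_of_length e 3 by move/(_ h).
exists [:: a; b; c]; split=> //=; last by rewrite ab bc e_sym ac.
by rewrite !inE !negb_or (edge_neq ab) (edge_neq ac) (edge_neq bc).
Qed.

(** Two different common neighbours [b], [d] would close the 4-cycle [a b c d]. *)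
Lemma unique_common_nbr a c b d :
  a != c -> e a b -> e c b -> e a d -> e c d -> b = d.
Proof.
move=> neq_ac ab cb ad cd; apply/eqP; apply: contraT => neq_bd.
have := girth5 (n := 4); suff h : has_cycle_of_length e 4 by move/(_ h).
exists [:: a; b; c; d]; split=> //=; last by rewrite ab (e_sym b) cb cd e_sym ad.
rewrite !inE !negb_or neq_ac neq_bd (edge_neq ab) (edge_neq ad) (edge_neq cd).
by rewrite eq_sym (edge_neq cb).
Qed.

Lemma in_nbhd v w : (w \in nbhd e v) = e v w.
Proof. exact: in_set. Qed.

Lemma card_nbhd v : #|nbhd e v| = degree e v.
Proof. by rewrite cardsE. Qed.

Lemma aut_degree f v : automorphism e f -> degree e (f v) = degree e v.
Proof.
case=> f_bij f_e; rewrite -!card_nbhd -[RHS](card_imset _ (bij_inj f_bij)).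
case: f_bij => g fK gK; congr (#|pred_of_set _|); apply/setP => w; rewrite inE.
apply/idP/imsetP => [fvw|[z /[!inE] vz ->]]; last by rewrite f_e.
by exists (g w); rewrite ?gK // inE -f_e gK.
Qed.

(** * Colouring one neighbourhood *)

(* The last clause says that a colour of F is used on w only if all the other
   colours occur among the coloured neighbours of w. *)
Lemma color_step k (C : {set T}) (phi : T -> 'I_k) (F : {set 'I_k}) u :
  u \in C -> proper_on e C phi -> (forall w, degree e w < k) ->
  #|nbhd e u :\: C| + #|phi u |: F| <= k ->
  exists phi1 : T -> 'I_k, [/\ {in C, phi1 =1 phi},
    proper_on e (C :|: nbhd e u) phi1,
    forall psi f, {in C :|: nbhd e u, psi =1 phi1} -> color_automorphism e psi f ->
      fixes f C -> fixes f (C :|: nbhd e u)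
    & forall w, w \in nbhd e u -> w \notin C -> phi1 w \in F ->
      forall c, c \notin F -> exists z, [/\ z \in C, e w z & phi z = c]].
Proof.
move=> uC prC deg_lt cardW.
(* The vertices of W1 are coloured injectively by g, the other ones by h. *)
pose W1 := [set w in nbhd e u :\: C | [forall z in C, e w z ==> (z == u)]].
pose P := ~: (phi u |: F).
have W1P : #|W1| <= #|P|.
  rewrite [#|P|]cardsCs setCK card_ord; apply: leq_trans (_ : #|nbhd e u :\: C| <= _).
    by apply: subset_leq_card; apply/subsetP => w /[!inE] /andP[].
  by rewrite leq_subRL ?(leq_trans _ cardW) ?leq_addl // addnC.
pose g w := nth (phi u) (enum P) (index w (enum W1)).
have idx w : w \in W1 -> index w (enum W1) < size (enum P).
  by move=> wW; apply: leq_trans (_ : size (enum W1) <= _);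
    rewrite ?index_mem ?mem_enum // -!cardE.
have gP w : w \in W1 -> g w \in P.
  by move=> wW; rewrite -mem_enum mem_nth ?idx.
have g_inj : {in W1 &, injective g}.
  move=> w w' wW w'W /eqP; rewrite /g nth_uniq ?idx ?enum_uniq //.
  by move/eqP/index_inj; apply; rewrite ?mem_enum.
pose used w := phi @: (nbhd e w :&: C).
(* A free colour outside [F] is preferred, then any free colour. The default [phi u] is never
   reached: fewer than [k] colours are used around [w]. *)
pose h w := odflt (odflt (phi u) [pick c | c \notin used w])
                  [pick c | (c \notin used w) && (c \notin F)].
have h_free w : h w \notin used w.
  rewrite /h; case: (pickP (fun c => (c \notin used w) && (c \notin F)))
    => [c /= /andP[] //|_] /=; case: pickP => [c //|/= full].
  have : k <= #|used w|.
    rewrite -{1}(card_ord k) subset_leq_card //; apply/subsetP => c _.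
    by have /negbFE := full c.
  rewrite leqNgt (leq_ltn_trans _ (deg_lt w)) // (leq_trans (leq_imset_card _ _)) //.
  by rewrite -card_nbhd; apply: subset_leq_card; apply: subsetIl.
have h_forced w : h w \in F -> forall c, c \notin F -> c \in used w.
  rewrite /h; case: (pickP (fun c => (c \notin used w) && (c \notin F)))
    => [c /= /andP[_ /negbTE ->] //|/= full] _ c cF.
  by have := full c; rewrite cF andbT => /negbFE.
pose phi1 w := if w \in C then phi w else if w \in W1 then g w else h w.
have phi1C : {in C, phi1 =1 phi} by move=> z zC; rewrite /phi1 zC.
have newC w z : w \notin C -> w \in nbhd e u -> z \in C -> e w z -> phi1 w <> phi z.
  move=> wC wu zC wz; rewrite /phi1 (negbTE wC); case: ifP => [wW1|_].
    move: (wW1); rewrite inE => /andP[_ /forall_inP/(_ z zC)].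
    rewrite wz => /eqP -> g_eq; have := gP _ wW1.
    by rewrite inE g_eq !inE eqxx.
  move=> h_eq; have /negP[] := h_free w; rewrite h_eq.
  by apply: imset_f; rewrite !inE wz.
exists phi1; split=> //.
- move=> z w zCu wCu zw.
  case: (boolP (z \in C)) => zC; case: (boolP (w \in C)) => wC.
  + by rewrite !phi1C //; apply: prC.
  + rewrite (phi1C z) // => /esym; apply: newC => //; last by rewrite e_sym.
    by move: wCu; rewrite inE (negbTE wC).
  + rewrite (phi1C w) //; apply: newC => //.
    by move: zCu; rewrite inE (negbTE zC).
  + move: wCu zCu; rewrite !inE (negbTE wC) (negbTE zC) /= => uw uz.
    by case: (no_triangle uz zw uw).
(* [psi] stands for any later extension of [phi1], so that fixing can be propagated once the whole
   graph is coloured. *)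
- move=> psi f psiE [[f_bij f_e] f_psi] fixC w.
  rewrite inE => /orP[/fixC //|] /[!inE] uw.
  case: (boolP (w \in C)) => [/fixC //|wC].
  have ufw : e u (f w) by rewrite -(fixC u uC) f_e.
  have [fwC|fwC] := boolP (f w \in C).
    exact: (bij_inj f_bij (fixC _ fwC)).
  (* Outside [W1] there is a second coloured neighbour [z]; both [w] and [f w] are common neighbours
     of [u] and [z], hence equal. Inside [W1], which [f] preserves here, the colours given by [g]
     are distinct. *)
  have [wW1|] := boolP (w \in W1); last first.
    rewrite !inE uw wC /= => /forall_inPn[z zC]; rewrite negb_imply => /andP[wz zu].
    apply: (@unique_common_nbr u z); rewrite 1?eq_sym //; last by rewrite e_sym.
    by rewrite -(fixC z zC) f_e e_sym.
  have fwW1 : f w \in W1.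
    rewrite !inE ufw fwC; apply/forall_inP => z zC; apply/implyP => fwz.
    move: wW1; rewrite inE => /andP[_ /forall_inP/(_ z zC)/implyP]; apply.
    by rewrite -f_e (fixC z zC).
  have := f_psi w; rewrite !psiE ?inE ?uw ?ufw ?orbT // /phi1 (negbTE wC) (negbTE fwC).
  by rewrite wW1 fwW1; apply: g_inj.
- move=> w wu wC; rewrite /phi1 (negbTE wC); case: ifP => [wW1|_].
    by have := gP _ wW1; rewrite !inE negb_or => /andP[_ /negbTE ->].
  move=> /h_forced full c /full /imsetP[z /setIP[/[!inE] wz zC] ->].
  by exists z.
Qed.

(** * Extension of a partial colouring to a connected graph *)

Hypothesis e_conn : connected e.

Lemma boundary_edge (C : {set T}) u z :
  u \in C -> z \notin C -> exists2 w, w \in C & exists2 w', e w w' & w' \notin C.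
Proof.
move=> uC; have /connectP[p] := e_conn u z.
elim: p u uC => [|y p IHp] u uC /= => [_ -> /negP //|/andP[uy pth] zE zC].
have [yC|yC] := boolP (y \in C); first exact: IHp yC pth zE zC.
by exists u => //; exists y.
Qed.

(** Induction on the number of uncoloured vertices, applying [color_step] with [F] reduced to colour
    0 at a vertex of [C] that has an uncoloured neighbour. The condition on [C] leaves at most
    [D - 1] uncoloured neighbours, and it is inherited because every new vertex is adjacent to
    [u]. *)
Lemma extend_coloring D (C : {set T}) (phi : T -> 'I_D.+1) :
  (forall w, degree e w <= D) ->
  C != set0 -> proper_on e C phi ->
  {in C, forall z, degree e z < D \/ exists2 y, y \in C & e z y} ->
  exists psi : T -> 'I_D.+1, [/\ {in C, psi =1 phi}, proper_coloring e psi,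
    forall f, color_automorphism e psi f -> fixes f C -> forall z, f z = z
    & forall z, z \notin C -> psi z = ord0 ->
      degree e z = D /\ {in nbhd e z &, injective psi}].
Proof.
move=> deg_le; move: {2}#|~: C|.+1 (ltnSn #|~: C|) => n.
elim: n C phi => // n IHn C phi; rewrite ltnS => le_n C0 prC nbrC.
have [CT|] := eqVneq C setT.
  exists phi; split=> // [z w|f _ fixC z|z]; last by rewrite CT inE.
    by apply: prC; rewrite CT inE.
  by apply: fixC; rewrite CT inE.
rewrite -subTset => /subsetPn[z _ zC].
have [u0 u0C] := set0Pn _ C0.
have [u uC [w uw wC]] := boundary_edge u0C zC.
have [||phi1 [phi1C pr1 fix1 zero1]] := @color_step _ C phi [set ord0] u uC prC.
- by move=> y; rewrite ltnS.
- have ltWD : #|nbhd e u :\: C| < D.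
    have [|[y yC uy]] := nbrC u uC.
      by apply: leq_ltn_trans; rewrite -card_nbhd subset_leq_card ?subsetDl.
    apply: leq_trans (deg_le u); rewrite -card_nbhd; apply: proper_card.
    by apply/properP; split; [apply: subsetDl | exists y; rewrite !inE ?uy ?yC].
  have le2 : #|phi u |: [set ord0]| <= 2 by rewrite cardsU1 cards1; case: (_ \in _).
  by apply: leq_trans (leq_add (leqnn _) le2) _; rewrite addn2 ltnS.
have [||||psi [psi1 pr_psi fix_psi zero_psi]] := IHn (C :|: nbhd e u) phi1.
- apply: leq_trans le_n; apply: proper_card; apply/properP.
  by rewrite setCS subsetUl; split=> //; exists w; rewrite !inE ?uw ?orbT.
- by apply/set0Pn; exists u; rewrite inE uC.
- by [].
- move=> y; rewrite inE => /orP[/nbrC[|[y' y'C yy']]|/[!inE] uy].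
  + by left.
  + by right; exists y' => //; rewrite inE y'C.
  + by right; exists u; rewrite ?inE ?uC // e_sym.
have psiC : {in C, psi =1 phi} by move=> y yC; rewrite psi1 ?phi1C // inE yC.
exists psi; split=> // [f f_aut fixC|y yC psi_y].
  by apply: fix_psi => //; apply: fix1 psi1 f_aut fixC.
have [yu|yu] := boolP (y \in nbhd e u); last first.
  by apply: zero_psi; rewrite // inE negb_or yC.
have phi1_y : phi1 y \in [set ord0] by rewrite -psi1 ?psi_y ?set11 // in_setU yu orbT.
(* Colour 0 was forced on [y], so all [D] other colours occur on its coloured neighbours. As [y] has
   at most [D] neighbours, all of them are coloured already, with distinct colours. *)
have cardD : D <= #|psi @: (nbhd e y :&: C)|.
  have card_nz : #|[set~ (ord0 : 'I_D.+1)]| = D by rewrite cardsC1 card_ord.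
  rewrite -[leqLHS]card_nz; apply: subset_leq_card; apply/subsetP => c; rewrite inE => c0.
  have [y' [y'C yy' <-]] := zero1 y yu yC phi1_y c c0.
  by rewrite -(psiC _ y'C) imset_f // !inE yy'.
have NC : nbhd e y :&: C = nbhd e y.
  apply/eqP; rewrite eqEcard subsetIl card_nbhd (leq_trans (deg_le y)) //.
  exact: leq_trans cardD (leq_imset_card _ _).
rewrite NC in cardD; split.
  apply/eqP; rewrite eqn_leq deg_le -card_nbhd.
  exact: leq_trans cardD (leq_imset_card _ _).
apply/imset_injP; rewrite eqn_leq leq_imset_card card_nbhd.
exact: leq_trans (deg_le y) cardD.
Qed.

(** * Graphs that are not regular *)

(** Start from [v] alone with colour 0. Every other vertex of colour 0 has degree [D], unlike [v],
    so [v] is fixed. *)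
Lemma nonregular_coloring D v :
  (forall w, degree e w <= D) -> degree e v < D -> chiD_le e D.+1.
Proof.
move=> deg_le ltvD.
have [||z w||psi [psiv pr_psi fix_psi zero_psi]] :=
    @extend_coloring D [set v] (fun=> ord0).
- exact: deg_le.
- by apply/set0Pn; exists v; rewrite inE.
- by rewrite !inE => /eqP -> /eqP ->; rewrite e_irr.
- by move=> z /set1P ->; left.
exists psi; split=> // f f_aut f_psi; apply: fix_psi => // _ /set1P ->.
apply/eqP; apply: contraT => fv.
case: (zero_psi (f v)); rewrite ?inE // ?f_psi ?psiv ?inE // aut_degree // => degv _.
by rewrite degv ltnn in ltvD.
Qed.

(** * Regular graphs of degree at least 2 *)

(** A new vertex gets colour [c0] or [c1] only if the [D - 1] other colours all occur around it. The
    last hypothesis prevents this: one such coloured neighbour implies [2 < D], hence two other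
    colours, while a second such neighbour is ruled out. *)
Lemma color_step_avoid D (C : {set T}) (phi : T -> 'I_D.+1) c0 c1 u :
  (forall w, degree e w <= D) -> 1 < D -> c0 != c1 ->
  u \in C -> proper_on e C phi -> (exists2 y, y \in C & e u y) ->
  phi u \in [set c0; c1] ->
  (forall w z z', e u w -> w \notin C -> z \in C -> z' \in C -> e w z -> e w z' ->
    phi z \notin [set c0; c1] -> phi z' \notin [set c0; c1] -> 2 < D /\ z = z') ->
  exists phi1 : T -> 'I_D.+1, [/\ {in C, phi1 =1 phi},
    proper_on e (C :|: nbhd e u) phi1,
    forall psi f, {in C :|: nbhd e u, psi =1 phi1} -> color_automorphism e psi f ->
      fixes f C -> fixes f (C :|: nbhd e u)
    & forall w, e u w -> w \notin C -> phi1 w \notin [set c0; c1]].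
Proof.
move=> deg_le D1 c01 uC prC [y yC uy] phi_u few; set F := [set c0; c1].
have cardF : #|F| = 2 by rewrite cards2 c01.
have [||phi1 [phi1C pr1 fix1 forced]] := @color_step _ C phi F u uC prC.
- by move=> w; rewrite ltnS.
- have -> : phi u |: F = F by apply/setUidPr; rewrite sub1set.
  rewrite cardF addn2 ltnS; apply: leq_trans (deg_le u).
  rewrite -card_nbhd; apply: proper_card.
  by apply/properP; split; [apply: subsetDl | exists y; rewrite !inE ?uy ?yC].
exists phi1; split=> // w uw wC; apply/negP => phi1F.
have {}forced := forced w _ wC phi1F; rewrite inE in forced.
have cardFc : #|~: F| = D.-1 by rewrite cardsCs setCK card_ord cardF subn2.
have [c cF] : exists c, c \in ~: F by apply/card_gt0P; rewrite cardFc -subn1 subn_gt0.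
have [z [zC wz phi_z]] : exists z, [/\ z \in C, e w z & phi z = c].
  by apply: forced => //; rewrite -in_setC.
have zF : phi z \notin F by rewrite phi_z -in_setC.
have [D2 _] := few w z z uw wC zC zC wz wz zF zF.
have [c'] : exists c', c' \in ~: F :\ c.
  apply/card_gt0P; move: (cardsD1 c (~: F)); rewrite cardFc cF => cardE.
  (* The summand [true] of [cardsD1], read as 1, is added on both sides. *)
  by rewrite -(ltn_add2l true) -cardE ltn_predRL.
rewrite in_setD1 in_setC => /andP[c'c c'F].
have [z' [z'C wz' phi_z']] := forced uw c' c'F.
have [|_ zz'] := few w z z' uw wC zC z'C wz wz' zF; first by rewrite phi_z'.
by move: c'c; rewrite -phi_z -phi_z' zz' eqxx.
Qed.

(** In degree 2 the cycle contains all neighbours of its vertices, so by connectedness it is the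
    whole graph. *)
Lemma six_cycle_C6 a0 a1 a2 a3 a4 a5 (s := [:: a0; a1; a2; a3; a4; a5]) :
  (forall v, degree e v = 2) -> uniq s -> cycle e s -> isomorphic e C6_rel.
Proof.
move=> deg2 s_uniq s_cycle.
have edge i : i < 6 -> e (nth a0 s i) (nth a0 s (i.+1 %% 6)).
  by move: s_cycle => /= /and5P[? ? ? ? /and3P[? ? _]]; do 6?[case: i => [//|i]].
(* Adding 5 modulo 6 gives the predecessor on the cycle. *)
have nbhdE i : i < 6 ->
    nbhd e (nth a0 s i) = [set nth a0 s (i.+1 %% 6); nth a0 s ((i + 5) %% 6)].
  move=> lt_i6; apply/esym/eqP; rewrite eqEcard card_nbhd deg2 cards2.
  rewrite nth_uniq ?ltn_mod //; have -> /= : i.+1 %% 6 != (i + 5) %% 6 by lia.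
  rewrite andbT subUset !sub1set !inE edge //= e_sym.
  have -> : nth a0 s i = nth a0 s (((i + 5) %% 6).+1 %% 6) by congr nth; lia.
  by apply: edge; rewrite ltn_mod.
have sT x : x \in s.
  have [//|xs] := boolP (x \in s).
  have [||w] := @boundary_edge [set y in s] a0 x; rewrite ?in_set ?mem_head //.
  move=> /(nthP a0)[i lt_i6 <-] [w'].
  by rewrite in_set -in_nbhd nbhdE // => /set2P[] ->; rewrite mem_nth ?ltn_mod.
have idx x : index x s < 6 by rewrite -[6]/(size s) index_mem.
exists (fun x => Ordinal (idx x)); split.
  exists (fun i : 'I_6 => nth a0 s i) => [x|i]; first exact: nth_index.
  by apply: val_inj; apply: index_uniq.
have C6E i j (lt_i6 : i < 6) (lt_j6 : j < 6) :
    C6_rel (Ordinal lt_i6) (Ordinal lt_j6) = (j == i.+1 %% 6) || (j == (i + 5) %% 6).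
  by rewrite /C6_rel /=; congr orb; lia.
move=> x y; rewrite C6E -[in RHS](nth_index a0 (sT x)) -[in RHS](nth_index a0 (sT y)).
by rewrite -[RHS]in_nbhd nbhdE // in_set2 !nth_uniq ?ltn_mod.
Qed.

Lemma card_gt2_nbrs a b c d D :
  (forall w, degree e w <= D) -> uniq [:: b; c; d] -> e a b -> e a c -> e a d -> 2 < D.
Proof.
move=> deg_le uniq_bcd ab ac ad; apply: leq_trans (deg_le a).
rewrite -card_nbhd; apply/card_gt2P; exists b, c, d; rewrite !in_nbhd; split=> //.
move: uniq_bcd; rewrite /= !inE negb_or andbT => /andP[/andP[-> bd] ->].
by rewrite eq_sym.
Qed.

(** The path [w1 v w2 x] is coloured 1, 0, 1, 0, and both colours are kept off the rest of its
    closed neighbourhood, the final set [C4]. An automorphism preserving the colours then fixes the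
    path, from which fixing spreads to the whole graph. *)
Lemma regular_coloring D (v : T) :
  (forall w, degree e w = D) -> 1 < D -> ~ isomorphic e C6_rel -> chiD_le e D.+1.
Proof.
move=> degD D1 notC6.
have deg_le w : degree e w <= D by rewrite degD.
have [w1 [w2 []]] : exists w1 w2, [/\ w1 \in nbhd e v, w2 \in nbhd e v & w1 != w2].
  by apply/card_gt1P; rewrite card_nbhd degD.
rewrite !in_nbhd => vw1 vw2 w12.
have [x] : exists x, x \in nbhd e w2 :\ v.
  apply/card_gt0P; move: (cardsD1 v (nbhd e w2)).
  by rewrite card_nbhd degD in_nbhd e_sym vw2; lia.
rewrite in_setD1 in_nbhd => /andP[xv w2x].
have w1v : e w1 v by rewrite e_sym.
have w2v : e w2 v by rewrite e_sym.
have xw2 : e x w2 by rewrite e_sym.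
have w1w2F : ~~ e w1 w2 by apply/negP => w1w2; exact: no_triangle vw1 w1w2 vw2.
have vxF : ~~ e v x by apply/negP => vx; exact: no_triangle vw2 w2x vx.
have w1xF : ~~ e w1 x.
  apply/negP => w1x; have /esym/eqP := unique_common_nbr w12 w1v w2v w1x w2x.
  by rewrite (negbTE xv).
have w1x : w1 != x by apply: contraNneq w1w2F => ->.
have w2x_neq := edge_neq w2x.
pose c0 : 'I_D.+1 := ord0; pose c1 : 'I_D.+1 := inord 1.
have c01 : c0 != c1 by rewrite -val_eqE /= inordK // ltnS ltnW.
set F := [set c0; c1].
have c0F : c0 \in F by rewrite !inE eqxx.
have c1F : c1 \in F by rewrite !inE eqxx orbT.
pose phi0 z := if z == v then c0 else c1.
have phi0v : phi0 v = c0 by rewrite /phi0 eqxx.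
have phi0w1 : phi0 w1 = c1 by rewrite /phi0 (negbTE (edge_neq w1v)).
have phi0w2 : phi0 w2 = c1 by rewrite /phi0 (negbTE (edge_neq w2v)).
have phi0F z : phi0 z \in F by rewrite /phi0; case: ifP.
pose C0 : {set T} := v |: [set w1; w2].
have vC0 : v \in C0 by rewrite !inE eqxx.
have w1C0 : w1 \in C0 by rewrite !inE eqxx orbT.
have w2C0 : w2 \in C0 by rewrite !inE eqxx !orbT.
have pr0 : proper_on e C0 phi0.
  have nbr_v z : z \in C0 -> z != v -> e v z.
    by rewrite !inE => /or3P[] /eqP-> //; rewrite eqxx.
  move=> z z' zC z'C zz'; rewrite /phi0.
  have [zv|zv] := eqVneq z v; have [z'v|z'v] := eqVneq z' v.
  - by rewrite zv z'v e_irr in zz'.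
  - by apply/eqP.
  - by apply/eqP; rewrite eq_sym.
  - by case: (no_triangle (nbr_v z zC zv) zz' (nbr_v z' z'C z'v)).
have [|||phi1 [phi1C0 pr1 fix1 new1]] :=
    @color_step_avoid D C0 phi0 c0 c1 w1 deg_le D1 c01 w1C0 pr0.
- by exists v.
- by rewrite phi0w1.
- by move=> w z z' _ _ zC _ _ _; rewrite phi0F.
pose C1 := C0 :|: nbhd e w1; rewrite -/C1 in pr1 fix1.
have sub01 : {subset C0 <= C1} by move=> z zC; rewrite inE zC.
(* Invariants of the successive sets C: the vertices coloured in F are those of
   C0 and x (old), the other ones are neighbours of the steps' centres (far). *)
have old1 z : z \in C1 -> phi1 z \in F -> z \in C0.
  rewrite in_setU in_nbhd; case: (boolP (z \in C0)) => //= zC w1z phiF.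
  by have := new1 z w1z zC; rewrite phiF.
have far1 z : z \in C1 -> phi1 z \notin F -> z != v /\ e w1 z.
  rewrite in_setU in_nbhd; case: (boolP (z \in C0)) => [zC _|zC /= w1z _].
    by rewrite phi1C0 ?phi0F.
  by split=> //; apply: contraNneq zC => ->.
have xC0 : x \notin C0.
  by rewrite !inE !negb_or xv eq_sym w1x eq_sym w2x_neq.
have xC1 : x \notin C1 by rewrite in_setU in_nbhd negb_or xC0.
(* In [C1] only [v] has colour [c0], and [x] is not adjacent to [v], so [x] can take this colour. *)
pose phi1' z := if z == x then c0 else phi1 z.
have phi1'x : phi1' x = c0 by rewrite /phi1' eqxx.
have phi1'C1 : {in C1, phi1' =1 phi1}.
  by move=> z zC; rewrite /phi1'; case: eqP xC1 => // <-; rewrite zC.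
pose C1' := x |: C1.
have sub11' : {subset C1 <= C1'} by move=> z zC; rewrite inE zC orbT.
have xC1' : x \in C1' by rewrite !inE eqxx.
have pr1' : proper_on e C1' phi1'.
  have x_ok z : z \in C1 -> e x z -> phi1 z <> c0.
    move=> zC xz phi_z; have := old1 z zC; rewrite phi_z c0F => /(_ isT).
    rewrite !inE => /or3P[] /eqP zE; move: xz phi_z; rewrite zE.
    - by rewrite e_sym (negbTE vxF).
    - by rewrite e_sym (negbTE w1xF).
    - by rewrite phi1C0 // phi0w2 => _ /eqP; rewrite eq_sym (negbTE c01).
  move=> z z' /setU1P[-> | zC] /setU1P[-> | z'C] zz'.
  - by rewrite e_irr in zz'.
  - by rewrite phi1'x phi1'C1 //; apply/nesym; apply: x_ok.
  - by rewrite phi1'x phi1'C1 //; apply: x_ok; rewrite // e_sym.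
  - by rewrite !phi1'C1 //; apply: pr1.
have far1' z : z \in C1' -> phi1' z \notin F -> z != v /\ e w1 z.
  move=> /setU1P[-> | zC]; first by rewrite phi1'x c0F.
  by rewrite phi1'C1 //; apply: far1.
have old1' z : z \in C1' -> phi1' z \in F -> z \in x |: C0.
  move=> /setU1P[-> _| zC]; first exact: setU11.
  by rewrite phi1'C1 // => /(old1 _ zC) zC0; rewrite in_setU zC0 orbT.
have phi1'w2 : phi1' w2 = c1 by rewrite phi1'C1 ?phi1C0 ?phi0w2 // sub01.
have same_w1 w z z' : w != w1 -> e w z -> e w z' -> e w1 z -> e w1 z' -> z = z'.
  by move=> ww1 wz wz' w1z w1z'; apply: (unique_common_nbr ww1).
have [|||phi2 [phi2C1' pr2 fix2 new2]] :=
    @color_step_avoid D C1' phi1' c0 c1 w2 deg_le D1 c01 (sub11' _ (sub01 _ w2C0)) pr1'.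
- by exists x.
- by rewrite phi1'w2.
(* Colours outside [F] occur so far only on neighbours of [w1], and [w] shares at most one neighbour
   with [w1]. The three neighbours [v], [x], [w] of [w2] give [2 < D]. *)
- move=> w z z' w2w wC zC z'C wz wz' /(far1' _ zC)[_ w1z] /(far1' _ z'C)[_ w1z'].
  have ww1 : w != w1 by apply: contraNneq wC => ->; rewrite sub11' ?sub01.
  split; last exact: same_w1 ww1 wz wz' w1z w1z'.
  apply: (@card_gt2_nbrs w2 v x w D) => //=; rewrite !inE negb_or eq_sym xv /= andbT.
  by apply/andP; split; apply: contraNneq wC => <-; rewrite ?xC1' ?sub11' ?sub01.
pose C2 := C1' :|: nbhd e w2; rewrite -/C2 in pr2 fix2.
have sub12 : {subset C1' <= C2} by move=> z zC; rewrite inE zC.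
have sub02 : {subset C0 <= C2} by move=> z zC; rewrite sub12 ?sub11' ?sub01.
have far2 z : z \in C2 -> phi2 z \notin F -> z != v /\ (e w1 z \/ e w2 z).
  rewrite in_setU in_nbhd; case: (boolP (z \in C1')) => [zC _|zC /= w2z _].
    by rewrite phi2C1' // => /(far1' _ zC)[]; split; [|left].
  by split; [apply: contraNneq zC => ->; rewrite sub11' ?sub01 | right].
have old2 z : z \in C2 -> phi2 z \in F -> z \in x |: C0.
  rewrite [z \in C2]in_setU in_nbhd; case: (boolP (z \in C1')) => [zC _|zC /= w2z].
    by rewrite phi2C1' //; apply: old1'.
  by rewrite (negbTE (new2 z w2z zC)).
have phi2x : phi2 x = c0 by rewrite phi2C1' ?phi1'x.
have [|||phi3 [phi3C2 pr3 fix3 new3]] :=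
    @color_step_avoid D C2 phi2 c0 c1 x deg_le D1 c01 (sub12 _ xC1') pr2.
- by exists w2; rewrite ?sub02.
- by rewrite phi2x.
(* The only common neighbour of [w] and [w2] is [x], whose colour is in [F]; so [z] must be adjacent
   to [w1]. *)
- have only_w1 w z : e x w -> w \notin C2 -> z \in C2 -> e w z -> phi2 z \notin F ->
      z != v /\ e w1 z.
    move=> xw wC zC wz zF; have [zv [//|w2z]] := far2 z zC zF.
    have ww2 : w != w2 by apply: contraNneq wC => ->; rewrite sub02.
    have wx : e w x by rewrite e_sym.
    by move: zF; rewrite -(unique_common_nbr ww2 wx w2x wz w2z) phi2x c0F.
  move=> w z z' xw wC zC z'C wz wz' /(only_w1 _ _ xw wC zC wz)[zv w1z].
  move=> /(only_w1 _ _ xw wC z'C wz')[_ w1z'].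
  have wNC y : y \in C2 -> y != w by apply: contraTneq => ->.
  have ww1 : w != w1 by rewrite eq_sym wNC ?sub02.
  split; last exact: same_w1 ww1 wz wz' w1z w1z'.
  (* If [D] is 2, then [v w1 z w x w2] is a 6-cycle, which makes the graph [C6]. *)
  rewrite ltnNge; apply/negP => D2; apply: notC6.
  have zx : z != x by apply: contraNneq w1xF => <-.
  have zw2 : z != w2 by apply: contraNneq w1w2F => <-.
  apply: (@six_cycle_C6 v w1 z w x w2) => [y|/=|/=].
  + by rewrite degD; apply/eqP; rewrite eqn_leq D2.
  + rewrite !inE !negb_or (edge_neq vw1) (edge_neq vw2) [v == z]eq_sym [v == x]eq_sym.
    rewrite zv xv (edge_neq w1z) w12 w1x zx zw2 (wNC z zC)
      (wNC _ (sub02 _ vC0)) (wNC _ (sub02 _ w1C0)).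
    by rewrite [w == x]eq_sym [w == w2]eq_sym [x == w2]eq_sym
      w2x_neq (wNC _ (sub12 _ xC1')) (wNC _ (sub02 _ w2C0)).
  + by rewrite vw1 w1z (e_sym z) wz (e_sym w) xw xw2 w2v.
pose C3 := C2 :|: nbhd e x; rewrite -/C3 in pr3 fix3.
have sub23 : {subset C2 <= C3} by move=> z zC; rewrite inE zC.
have sub03 : {subset C0 <= C3} by move=> z zC; rewrite sub23 ?sub02.
have xC3 : x \in C3 by rewrite sub23 ?sub12.
have far3 z : z \in C3 -> phi3 z \notin F -> z != v /\ [\/ e w1 z, e w2 z | e x z].
  rewrite in_setU in_nbhd; case: (boolP (z \in C2)) => [zC _|zC /= xz _].
    rewrite phi3C2 // => /(far2 _ zC)[zv [w1z|w2z]]; split=> //.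
      by constructor 1.
    by constructor 2.
  by split; [apply: contraNneq zC => ->; rewrite sub02 | constructor 3].
have old3 z : z \in C3 -> phi3 z \in F -> z \in x |: C0.
  rewrite [z \in C3]in_setU in_nbhd; case: (boolP (z \in C2)) => [zC _|zC /= xz].
    by rewrite phi3C2 //; apply: old2.
  by rewrite (negbTE (new3 z xz zC)).
have phi3v : phi3 v = c0.
  by rewrite phi3C2 ?phi2C1' ?phi1'C1 ?phi1C0 ?phi0v ?sub02 ?sub11' ?sub01.
have [|||phi4 [phi4C3 pr4 fix4 new4]] :=
    @color_step_avoid D C3 phi3 c0 c1 v deg_le D1 c01 (sub03 _ vC0) pr3.
- by exists w1; rewrite ?sub03.
- by rewrite phi3v.
(* The only neighbour that [w] shares with [w1] or with [w2] is [v], so [z] must be adjacent to [x].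
   Here the neighbours [w1], [w2], [w] of [v] give [2 < D]. *)
- have only_x w z : e v w -> w \notin C3 -> z \in C3 -> e w z -> phi3 z \notin F -> e x z.
    move=> vw wC zC wz zF; have wv : e w v by rewrite e_sym.
    have wNC y : y \in C3 -> w != y by apply: contraTneq => <-.
    have [zv [w1z|w2z|//]] := far3 z zC zF.
      have ww1 := wNC _ (sub03 _ w1C0).
      by move: zv; rewrite (unique_common_nbr ww1 wv w1v wz w1z) eqxx.
    have ww2 := wNC _ (sub03 _ w2C0).
    by move: zv; rewrite (unique_common_nbr ww2 wv w2v wz w2z) eqxx.
  move=> w z z' vw wC zC z'C wz wz' /(only_x _ _ vw wC zC wz) xz.
  move=> /(only_x _ _ vw wC z'C wz') xz'.
  have wNC y : y \in C3 -> y != w by apply: contraTneq => ->.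
  split; last by apply: (@unique_common_nbr w x) => //; rewrite eq_sym wNC.
  by apply: (@card_gt2_nbrs v w1 w2 w D) => //=; rewrite !inE negb_or w12 !wNC ?sub03.
pose C4 := C3 :|: nbhd e v; rewrite -/C4 in pr4 fix4.
have sub34 : {subset C3 <= C4} by move=> z zC; rewrite inE zC.
have sub04 : {subset C0 <= C4} by move=> z zC; rewrite sub34 ?sub03.
have xC4 : x \in C4 by rewrite sub34.
have old4 z : z \in C4 -> phi4 z \in F -> z \in x |: C0.
  rewrite [z \in C4]in_setU in_nbhd; case: (boolP (z \in C3)) => [zC _|zC /= vz].
    by rewrite phi4C3 //; apply: old3.
  by rewrite (negbTE (new4 z vz zC)).
have [||||psi [psiC4 pr_psi fix_psi zero_psi]] := @extend_coloring D C4 phi4.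
- exact: deg_le.
- by apply/set0Pn; exists x.
- exact: pr4.
- move=> z zC; right; have [zC0|zC0] := boolP (z \in C0).
    move: zC0; rewrite !inE => /or3P[] /eqP->.
    + by exists w1; rewrite ?sub04.
    + by exists v; rewrite ?sub04.
    + by exists v; rewrite ?sub04.
  case/setUP: zC => [/setUP[/setUP[/setU1P[->|/setUP[|]]|]|]|].
  + by exists w2; rewrite ?sub04.
  + by rewrite (negbTE zC0).
  + by rewrite in_nbhd e_sym => zw1; exists w1; rewrite ?sub04.
  + by rewrite in_nbhd e_sym => zw2; exists w2; rewrite ?sub04.
  + by rewrite in_nbhd e_sym => zx; exists x.
  + by rewrite in_nbhd e_sym => zv; exists v; rewrite ?sub04.
have psi3 : {in C3, psi =1 phi3} by move=> z zC; rewrite psiC4 ?phi4C3 // sub34.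
have psi2 : {in C2, psi =1 phi2} by move=> z zC; rewrite psi3 ?phi3C2 // sub23.
have psi1' : {in C1', psi =1 phi1'} by move=> z zC; rewrite psi2 ?phi2C1' // sub12.
have psi1 : {in C1, psi =1 phi1} by move=> z zC; rewrite psi1' ?phi1'C1 // sub11'.
have psi0 : {in C0, psi =1 phi0} by move=> z zC; rewrite psi1 ?phi1C0 // sub01.
have psiv : psi v = c0 by rewrite psi0.
have psiw1 : psi w1 = c1 by rewrite psi0.
have psiw2 : psi w2 = c1 by rewrite psi0.
have psix : psi x = c0 by rewrite psi1'.
have zeros z : z \in C4 -> psi z = c0 -> z = v \/ z = x.
  move=> zC psi_z; have := old4 z zC; rewrite -psiC4 // psi_z c0F => /(_ isT).
  case/setU1P=> [|/setU1P[|/set2P[] zE]]; [by right | by left | |];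
    by move: psi_z; rewrite zE ?psiw1 ?psiw2 => /eqP; rewrite eq_sym (negbTE c01).
have ones z : z \in C4 -> psi z = c1 -> z = w1 \/ z = w2.
  move=> zC psi_z; have := old4 z zC; rewrite -psiC4 // psi_z c1F => /(_ isT).
  case/setU1P=> [zE|/setU1P[zE|/set2P //]];
    by move: psi_z; rewrite zE ?psix ?psiv => /eqP; rewrite (negbTE c01).
have nbr_w1 z : e w1 z -> z \in C4.
  by move=> uz; rewrite sub34 ?sub23 ?sub12 ?sub11' // in_setU in_nbhd uz orbT.
have nbr_w2 z : e w2 z -> z \in C4.
  by move=> uz; rewrite sub34 ?sub23 // in_setU in_nbhd uz orbT.
have nbr_x z : e x z -> z \in C4.
  by move=> uz; rewrite sub34 // in_setU in_nbhd uz orbT.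
have nbr_v z : e v z -> z \in C4 by move=> uz; rewrite in_setU in_nbhd uz orbT.
exists psi; split=> // f f_aut f_psi; apply: fix_psi => //.
have [f_bij f_e] := f_aut; have f_inj := bij_inj f_bij.
have psi_aut : color_automorphism e psi f by [].
have fw12 : f w1 != f w2 by rewrite inj_eq.
(* Outside [C4] a vertex of colour 0 has neighbours of distinct colours, but [f w1] and [f w2] both
   have colour 1. Inside, the alternative is [f v = x]; then [f w1] and [f w2] would both be [w2],
   the only neighbour of [x] of colour 1. *)
have fv : f v = v.
  have fvw1 : e (f v) (f w1) by rewrite f_e.
  have fvw2 : e (f v) (f w2) by rewrite f_e.
  have [fvC|fvC] := boolP (f v \in C4); last first.
    have [|_ inj] := zero_psi _ fvC; first by rewrite f_psi.
    by case/eqP: fw12; apply: inj; rewrite ?in_nbhd // !f_psi psiw1.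
  have [||//|fvx] := zeros (f v); rewrite ?f_psi //.
  rewrite fvx in fvw1 fvw2; have xw1F : ~~ e x w1 by rewrite e_sym.
  have [||E1|E1] := ones (f w1); rewrite ?nbr_x ?f_psi //.
    by rewrite E1 (negbTE xw1F) in fvw1.
  have [||E2|E2] := ones (f w2); rewrite ?nbr_x ?f_psi //.
    by rewrite E2 (negbTE xw1F) in fvw2.
  by rewrite E1 E2 eqxx in fw12.
have f_nbr w : e v w -> e v (f w) by rewrite -{2}fv f_e.
(* If [f w1 = w2], the preimage of [x] is a neighbour of [w1] of colour 0. It is not [v], which is
   fixed, nor [x], which is not adjacent to [w1]. *)
have fw1 : f w1 = w1.
  have [||//|E1] := ones (f w1); rewrite ?nbr_v ?f_nbr ?f_psi //.
  have [g fK gK] := f_bij.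
  have w1gx : e w1 (g x) by rewrite -f_e gK E1.
  have psi_gx : psi (g x) = c0 by rewrite -f_psi gK.
  have [gx|gx] := zeros (g x) (nbr_w1 _ w1gx) psi_gx.
    by move: xv; rewrite -(gK x) gx fv eqxx.
  by rewrite gx (negbTE w1xF) in w1gx.
have fw2 : f w2 = w2.
  have [||E2|//] := ones (f w2); rewrite ?nbr_v ?f_nbr ?f_psi //.
  by rewrite fw1 E2 eqxx in fw12.
have fx : f x = x.
  have w2fx : e w2 (f x) by rewrite -fw2 f_e.
  have [||E|//] := zeros (f x); rewrite ?nbr_w2 ?f_psi //.
  by move: xv; rewrite -(inj_eq f_inj) E fv eqxx.
have fixC0 : fixes f C0 by move=> z; rewrite !inE => /or3P[] /eqP->.
have fixC1 := fix1 psi f psi1 psi_aut fixC0.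
have fixC1' : fixes f C1' by move=> z /setU1P[->|/fixC1].
exact: fix4 psiC4 psi_aut (fix3 _ _ psi3 psi_aut (fix2 _ _ psi2 psi_aut fixC1')).
Qed.

End GirthFive.

(** * Case distinction on regularity and degree *)

Theorem theorem1 (T : finType) (e : rel T)
  (Hsimple : simple_graph e)
  (Hconn : connected e)
  (Hgirth : girth_ge e 5)
  (HnotC6 : ~ isomorphic e C6_rel) :
  chiD_le e (max_degree e).+1.
Proof.
case: Hsimple => e_sym e_irr; set D := max_degree e.
have deg_le w : degree e w <= D by apply: (leq_bigmax (F := degree e)).
have [/existsP[v ltvD]|reg] := boolP [exists v, degree e v < D].
  exact: (nonregular_coloring e_sym e_irr Hgirth Hconn deg_le ltvD).
have degD w : degree e w = D.
  apply/eqP; rewrite eqn_leq deg_le leqNgt.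
  by apply: contra reg => ltwD; apply/existsP; exists w.
have [v _|T0] := pickP T; last first.
  by exists (fun=> ord0); split=> [w|f _ _ w]; have := T0 w.
have [D1|D1] := ltnP 1 D.
  exact: (regular_coloring e_sym e_irr Hgirth Hconn v degD D1 HnotC6).
(* In degree at most 1, every vertex other than [v] is adjacent to [v], so the graph is a single
   vertex or a single edge. Colour 0 on [v] and the last colour elsewhere suffice. *)
have few_nbrs u w w' : e u w -> e u w' -> w = w'.
  move=> uw uw'; apply/eqP; apply: contraT => ww'.
  have : 1 < #|nbhd e u| by apply/card_gt1P; exists w, w'; rewrite !in_nbhd.
  by rewrite card_nbhd degD ltnNge D1.
have near u : u != v -> e v u.
  rewrite -(in_nbhd e) => uv; apply: contraT => vuF.
  have [||w] := @boundary_edge _ e Hconn (v |: nbhd e v) v u.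
  - exact: setU11.
  - by rewrite in_setU1 negb_or uv.
  move=> /setU1P[->|vw] [w' ww']; rewrite in_setU1 in_nbhd ?ww' ?orbT //.
  by rewrite in_nbhd e_sym in vw; rewrite (few_nbrs w w' v) ?eqxx.
have D_gt0 u : e v u -> (ord_max : 'I_D.+1) <> ord0.
  move=> vu /(congr1 val) /= D0; have : 0 < #|nbhd e v|.
    by apply/card_gt0P; exists u; rewrite in_nbhd.
  by rewrite card_nbhd degD D0.
exists (fun u => if u == v then ord0 else ord_max); split=> [u w uw|f [f_bij _] f_psi].
  have [uv|/near vu] := eqVneq u v; have [wv|/near vw] := eqVneq w v.
  - by rewrite uv wv e_irr in uw.
  - exact/nesym/(D_gt0 w).
  - exact: (D_gt0 u).
  - by have := no_triangle e_sym e_irr Hgirth vu uw vw.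
have fv : f v = v.
  have [//|fv] := eqVneq (f v) v; have := f_psi v.
  by rewrite eqxx (negbTE fv) => /(D_gt0 _ (near _ fv)).
move=> u; have [->//|uv] := eqVneq u v.
apply: (few_nbrs v); apply: near => //.
by rewrite -[X in _ != X]fv (inj_eq (bij_inj f_bij)).
Qed.
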